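(* Let $G=(V,E)$ be a simple undirected graph (the vertex set $V$ is not assumed finite). Consider the conditions: (D) $G$ admits a graph derangement; (H) for every subset $X\subseteq V$, $\#X\leq \#N(X)$ (as cardinalities); (H$'$) for every finite subset $X\subseteq V$, $\#X\leq \#N(X)$. (a) Then (D) implies (H), and (H) implies (H$'$). (b) If $G$ is locally finite, then (H$'$) implies (D); hence for locally finite $G$ the three conditions (D), (H), (H$'$) are equivalent.
   Context: Write $x\sim y$ if $\{x,y\}\in E$. For $X\subseteq V$, its neighborhood is $N(X)=\{y\in V:\exists x\in X,\ x\sim y\}$ (note $N(X)$ may intersect $X$). A graph is locally finite if every vertex lies in finitely many edges. A graph derangement of $G$ is an injective map $f:V\to V$ with $f(v)\sim v$ for all $v\in V$. *)

(* Defs.v *)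
From mathcomp Require Import all_boot.
From mathcomp Require Import boolp classical_sets functions cardinality.

Set Implicit Arguments.
Unset Strict Implicit.
Unset Printing Implicit Defensive.

Local Open Scope classical_set_scope.
Local Open Scope card_scope.

(* Edges are unordered pairs of distinct vertices, so loops and multiple edges
   are excluded. *)
Record simple_graph (V : Type) := SimpleGraph {
  edges : set (set V);
  edgesP : forall e, edges e -> exists x y : V, x <> y /\ e = [set x; y] }.

Definition adj (V : Type) (G : simple_graph V) (x y : V) : Prop :=
  edges G [set x; y].

Definition neighborhood (V : Type) (G : simple_graph V) (X : set V) : set V :=
  [set y | exists x, X x /\ adj G x y].

Definition locally_finite (V : Type) (G : simple_graph V) : Prop :=
  forall v : V, finite_set [set e | edges G e /\ e v].

Definition graph_derangement (V : Type) (G : simple_graph V) (f : V -> V) :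
    Prop :=
  injective f /\ forall v, adj G (f v) v.

Definition condD (V : Type) (G : simple_graph V) : Prop :=
  exists f : V -> V, graph_derangement G f.

Definition condH (V : Type) (G : simple_graph V) : Prop :=
  forall X : set V, X #<= neighborhood G X.

Definition condH' (V : Type) (G : simple_graph V) : Prop :=
  forall X : set V, finite_set X -> X #<= neighborhood G X.

(* Main.v *)
(** Rado's argument.  Among the subfamilies [M i] of the finite sets [N i] which
    still satisfy Hall's condition take a minimal one (Zorn; finiteness of
    [N i] makes a chain stabilise on each finite set of indices).  If [x1 <> x2]
    both lay in [M v], then deleting either of them from [M v] would break
    Hall's condition, giving finite sets [A1], [A2] not containing [v] with
    #|M(Ak) U (M v \ xk)| <= #|Ak|.  The unions of the two left-hand sets
    contains M(A1 U A2 U {v}) and their intersection contains M(A1 I A2), so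
    #|A1 U A2| + 1 + #|A1 I A2| <= #|A1| + #|A2|, which is absurd.  Hence every
    [M v] is a singleton, and Hall's condition on pairs gives injectivity. *)
Require Import Defs.
From mathcomp Require Import all_boot finmap.
From mathcomp Require Import boolp classical_sets functions cardinality.

Section Hall.
Set Implicit Arguments.
Unset Strict Implicit.
Local Open Scope fset_scope.
Context {I T : choiceType}.
Implicit Types (M N : I -> {fset T}) (A B : {fset I}).

Definition nbhd M A : {fset T} := \bigcup_(i <- A) M i.

Definition hall M := forall A, #|` A| <= #|` nbhd M A|.

Lemma nbhdP M A x : reflect (exists2 i, i \in A & x \in M i) (x \in nbhd M A).
Proof.
apply: (iffP (bigfcupP _ _ _ _)) => [[i]|[i iA xi]]; last by exists i; rewrite ?iA.
by rewrite andbT; exists i.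
Qed.

Lemma nbhd_sub M N A :
  (forall i, i \in A -> M i `<=` N i) -> nbhd M A `<=` nbhd N A.
Proof.
move=> MN; apply/fsubsetP => x /nbhdP[i iA xi]; apply/nbhdP; exists i => //.
exact: (fsubsetP (MN _ iA)).
Qed.

Definition del M v x : I -> {fset T} :=
  fun i => if i == v then M i `\ x else M i.

(** A violating set must contain [v], since the family is unchanged elsewhere. Dropping [v] from it
    lowers its size by one, which turns the strict inequality into a weak one. *)
Lemma del_defect M v x : hall M -> ~ hall (del M v x) ->
  exists2 A, v \notin A & #|` nbhd M A `|` (M v `\ x)| <= #|` A|.
Proof.
move=> hM /existsNP[B /negP]; rewrite -ltnNge => ltB.
have vB : v \in B.
  apply: contraLR ltB => vB; rewrite -leqNgt.
  apply: leq_trans (hM B) (fsubset_leq_card (nbhd_sub _)) => i iB.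
  by rewrite /del ifN //; apply: contraNneq vB => <-.
exists (B `\ v); first by rewrite !inE eqxx.
rewrite -ltnS; have := cardfsD1 v B; rewrite vB add1n => <-.
apply: leq_ltn_trans ltB; apply: fsubset_leq_card; apply/fsubsetP => y.
rewrite inE => /orP[/nbhdP[i]|yv].
  rewrite !inE => /andP[iv iB] yi; apply/nbhdP; exists i => //.
  by rewrite /del (negPf iv).
by apply/nbhdP; exists v => //; rewrite /del eqxx.
Qed.

Lemma del_hall M v x1 x2 : hall M -> x1 != x2 ->
  hall (del M v x1) \/ hall (del M v x2).
Proof.
move=> hM x12; apply: contrapT => /not_orP[].
move=> /(del_defect hM)[A1 vA1 le1] /(del_defect hM)[A2 vA2 le2].
set U1 := _ `|` _ in le1; set U2 := _ `|` _ in le2.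
have leU : #|` v |` (A1 `|` A2)| <= #|` U1 `|` U2|.
  apply: leq_trans (hM _) (fsubset_leq_card _); apply/fsubsetP => y /nbhdP[i].
  rewrite !inE => /orP[/eqP-> yv|/orP[iA|iA] yi].
  (* As [x1 != x2], each element of [M v] survives at least one of the two deletions. *)
  - rewrite yv !andbT; case: (eqVneq y x1) => [->|]; last by rewrite !orbT.
    by rewrite x12 !orbT.
  - by have -> : y \in nbhd M A1 by apply/nbhdP; exists i.
  - by have -> : y \in nbhd M A2 by [apply/nbhdP; exists i]; rewrite !orbT.
have leI : #|` A1 `&` A2| <= #|` U1 `&` U2|.
  apply: leq_trans (hM _) (fsubset_leq_card _); apply/fsubsetP => y /nbhdP[i].
  rewrite inE => /andP[i1 i2] yi; rewrite inE.
  by apply/andP; split; rewrite inE; apply/orP; left; apply/nbhdP; exists i.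
have := leq_add leU leI; rewrite cardfsUI cardfsU1 inE negb_or vA1 vA2 /=.
by rewrite -addnA cardfsUI => /leq_trans/(_ (leq_add le1 le2)); rewrite add1n ltnn.
Qed.

(** Oriented downwards, so that the maximal elements given by Zorn's lemma are the minimal
    families. *)
Definition refines M N := forall i, N i `<=` M i.

(** Take the member of the chain with least total size over [A]. A member refining it has the same
    total, hence the same set at each index of [A]. *)
Lemma chain_stationary (S : set (I -> {fset T})) A M0 :
  S M0 -> total_on S refines ->
  exists2 M, S M & forall N i, S N -> i \in A -> M i `<=` N i.
Proof.
move=> SM0 Stot.
pose w M := \sum_(i <- A) #|` M i|.
pose P k := `[< exists2 M, S M & w M = k >].
have exP : exists k, P k by exists (w M0); apply/asboolP; exists M0.
case: (ex_minnP exP) => _ /asboolP[M SM <-] minM.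
exists M => // N i SN iA; case: (Stot _ _ SM SN) => [MN|]; last exact.
have /eqP : w N == w M.
  rewrite eqn_leq leq_sum /=; last by move=> j _; apply: fsubset_leq_card.
  by apply: minM; apply/asboolP; exists N.
rewrite /w !(big_fsetD1 i iA) /= => eqw.
have le_tl : \sum_(j <- A `\ i) #|` N j| <= \sum_(j <- A `\ i) #|` M j|.
  by apply: leq_sum => j _; apply: fsubset_leq_card.
suff : N i == M i by move=> /eqP ->.
by rewrite eqEfcard MN -(leq_add2r (\sum_(j <- A `\ i) #|` N j|)) eqw leq_add2l.
Qed.

Lemma exists_minimal_hall N : hall N -> exists M,
  [/\ refines N M, hall M & forall M', hall M' -> refines M M' -> refines M' M].
Proof.
move=> hN.
pose F := {M | refines N M /\ hall M}.
pose R (M M' : F) := `[< refines (sval M) (sval M') >].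
have Nrefl M : refines M M by move=> i.
have Rtrans M1 M2 M3 : refines M1 M2 -> refines M2 M3 -> refines M1 M3.
  by move=> M12 M23 i; apply: fsubset_trans (M12 i).
have [| | |[M [NM hM]] maxM] := @ZL_preorder F (exist _ N (conj (Nrefl N) hN)) R.
- by move=> M; apply/asboolP.
- by move=> M2 M1 M3 /asboolP M12 /asboolP M23; apply/asboolP/(Rtrans _ _ _ M12).
- move=> C Ctot.
  have [[M0 CM0]|C0] := pselect (exists s, C s); last first.
    (* The empty chain is bounded by [N] itself. *)
    exists (exist _ N (conj (Nrefl N) hN)) => M CM.
    by case: C0; exists M.
  pose S : set (I -> {fset T}) := [set sval s | s in C]%classic.
  have SM0 : S (sval M0) by exists M0.
  have Stot : total_on S refines.
    move=> _ _ [M CM <-] [M' CM' <-].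
    by case: (Ctot _ _ CM CM') => /asboolP; [left|right].
  (* The pointwise intersection of the chain, carved out of [N i] to be a finite set. *)
  pose L i : {fset T} := [fset x in N i | `[< forall M, S M -> x \in M i >]].
  have LM M : S M -> refines M L.
    by move=> SM i; apply/fsubsetP => x; rewrite !inE => /andP[_ /asboolP]; apply.
  have NL : refines N L by move=> i; apply/fsubsetP => x; rewrite !inE => /andP[].
  (* Hall's condition for a given [A] involves finitely many indices, and there [L] contains a
     single member of the chain. *)
  have hL : hall L.
    move=> A; have [M SM minM] := chain_stationary A SM0 Stot.
    have [M' _ eM'] := SM; have [NM hM] := svalP M'; rewrite eM' in NM hM.
    apply: leq_trans (hM A) (fsubset_leq_card (nbhd_sub _)) => i iA.
    apply/fsubsetP => x xM; rewrite !inE (fsubsetP (NM i) _ xM) /=.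
    by apply/asboolP => M1 SM1; exact: (fsubsetP (minM _ _ SM1 iA)).
  exists (exist _ L (conj NL hL)) => M CM; apply/asboolP => /=.
  by apply: LM; exists M.
exists M; split => // M' hM' MM'.
have /asboolP := maxM (exist _ M' (conj (Rtrans _ _ _ NM MM') hM')) (asboolT MM').
exact.
Qed.

Theorem hall_transversal N : hall N ->
  exists f : I -> T, injective f /\ forall i, f i \in N i.
Proof.
move=> /exists_minimal_hall[M [NM hM minM]].
have nbhd1 v : nbhd M [fset v] = M v by rewrite /nbhd big_seq_fset1.
have sing v x y : x \in M v -> y \in M v -> x = y.
  move=> xv yv; apply/eqP; apply: contraT => xy.
  have delK z : z \in M v -> ~ hall (del M v z).
    move=> zv /minM minz; have /minz/(_ v)/fsubsetP/(_ _ zv) : refines M (del M v z).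
      by move=> i; rewrite /del; case: eqP => // _; apply: fsubD1set.
    by rewrite /del eqxx !inE eqxx.
  by have [/(delK _ xv)|/(delK _ yv)] := del_hall v hM xy.
have ex v : exists x, x \in M v.
  apply/fset0Pn; rewrite -cardfs_gt0 -nbhd1.
  by apply: leq_trans (hM [fset v]); rewrite cardfs1.
have [f fM] := choice ex.
exists f; split => [u v fuv|v]; last exact: (fsubsetP (NM v)).
(* If [f u = f v], then [M u] and [M v] are the same singleton, too small for the pair [u], [v]. *)
apply/eqP; apply: contraT => uv.
have := hM [fset u; v]; rewrite cardfs2 uv => /leq_trans.
suff /fsubset_leq_card le1 : nbhd M [fset u; v] `<=` [fset f u].
  by move=> /(_ _ le1); rewrite cardfs1.
apply/fsubsetP => x /nbhdP[w]; rewrite !inE => /orP[]/eqP-> xw; apply/eqP.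
  exact: (sing u).
by rewrite fuv; apply: (sing v).
Qed.

End Hall.

Local Open Scope classical_set_scope.
Local Open Scope card_scope.

Lemma card_le_fset {I T : choiceType} (A : {fset I}) (B : {fset T}) :
  [set` A] #<= [set` B] -> #|` A| <= #|` B|.
Proof.
rewrite -card_le_II.
have /card_eq_fsetP/card_le_eql <- := erefl #|` A|.
by have /card_eq_fsetP/card_le_eqr <- := erefl #|` B|.
Qed.

Lemma adj_sym {V : Type} (G : simple_graph V) x y : adj G x y -> adj G y x.
Proof. by rewrite /adj setUC. Qed.

(** The map sending [y] to the edge [[set y; v]] embeds the neighbors of [v] into the edges at
    [v]. *)
Lemma locally_finite_neighbors {V : Type} (G : simple_graph V) (v : V) :
  locally_finite G -> finite_set [set y | adj G y v].
Proof.
move=> /(_ v); apply: card_le_finite.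
have finj : {in [set y | adj G y v] &, injective (fun y => [set y; v])}.
  move=> y z _ _ yzv.
  have : [set z; v] y by rewrite -yzv; left.
  have : [set y; v] z by rewrite yzv; left.
  by move=> [->|->] // [].
rewrite -(card_le_eql (inj_card_eq finj)); apply: subset_card_le.
by move=> _ [y yv <-]; split => //; right.
Qed.

Lemma condD_condH {V : Type} (G : simple_graph V) : condD G -> condH G.
Proof.
move=> [f [finj fadj]] X.
have fX : {in X &, injective f} by move=> x y _ _; exact: finj.
rewrite -(card_le_eql (inj_card_eq fX)); apply: subset_card_le.
by move=> _ [x Xx <-]; exists x; split => //; apply: adj_sym.
Qed.

(** A derangement is an injective transversal of the family of vertex neighborhoods, whose union
    over [A] is the neighborhood of [A]. *)
Lemma condH'_condD {V : choiceType} (G : simple_graph V) :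
  locally_finite G -> condH' G -> condD G.
Proof.
move=> lfG hG.
pose N (v : V) : {fset V} := fset_set [set y | adj G y v].
have NE v y : (y \in N v) = `[< adj G y v >].
  by rewrite in_fset_set //; apply: locally_finite_neighbors.
have hN : hall N.
  move=> A; apply: card_le_fset; apply: card_le_trans (hG _ (finite_fset A)) _.
  apply: subset_card_le => y [x [xA xy]]; apply/nbhdP; exists x => //.
  by rewrite NE; apply/asboolP/adj_sym.
have [f [finj fN]] := hall_transversal hN.
by exists f; split => // v; apply/asboolP; rewrite -NE.
Qed.

Theorem theorem7 (V : Type) (G : simple_graph V) :
  ((condD G -> condH G) /\ (condH G -> condH' G)) /\
  (locally_finite G ->
    (condH' G -> condD G) /\
    ((condD G <-> condH G) /\ (condH G <-> condH' G))).
Proof.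
have DH : condD G -> condH G by exact: condD_condH.
have HH' : condH G -> condH' G by move=> hG X _.
split=> // lfG.
(* [{classic V}] gives the bare type [V] the choice structure that Hall's theorem asks for. *)
have H'D : condH' G -> condD G by exact: (@condH'_condD {classic V}).
by split=> //; split; split=> // h; [apply/H'D/HH'|apply/DH/H'D].
Qed.
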